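(* Let $K$ be a simplicial complex with $n$ vertices and let $X_1,\dots,X_n$ be 1-connected CW-complexes. Then the polyhedral product $Z_K(\underline{C\Omega X},\underline{\Omega X})$ is 1-connected.
   Context: A simplicial complex $K$ with $n$ vertices is a collection of subsets of $[n]=\{1,\dots,n\}$, closed under taking subsets, containing $\varnothing$ and every singleton $\{i\}$. For pairs $(\underline X,\underline A)=\{(X_i,A_i)\}_{i=1}^n$, the polyhedral product is $$Z_K(\underline X,\underline A)=\bigcup_{\sigma\in K}D(\sigma)\subseteq \prod_{i=1}^n X_i,\qquad D(\sigma)=\prod_{i=1}^n Y_i,\quad Y_i=X_i \text{ if } i\in\sigma,\ Y_i=A_i\text{ if } i\notin\sigma.$$ $\Omega X$ is the based loop space of $X$, $CY$ is the cone on $Y$ (with $Y\subset CY$ as the base of the cone), and $Z_K(\underline{C\Omega X},\underline{\Omega X})$ denotes $Z_K$ of the pairs $\{(C\Omega X_i,\Omega X_i)\}_{i=1}^n$. Spaces are taken in the homotopy category of pointed CW-complexes, so $\Omega X_i$ may be replaced by a homotopy equivalent CW-complex. A space is 1-connected if it is path-connected and has trivial fundamental group. *)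

(* Defs.v *)
From HB Require Import structures.
From mathcomp Require Import all_boot all_order all_algebra generic_quotient.
From mathcomp Require Import all_classical all_reals topology.
From mathcomp Require Import normedtype homotopy.

Set Implicit Arguments.
Unset Strict Implicit.
Unset Printing Implicit Defensive.

Import Order.TTheory GRing.Theory Num.Theory.
Import numFieldNormedType.Exports.

Local Open Scope classical_set_scope.
Local Open Scope ring_scope.
Local Open Scope quotient_scope.

Section unit_interval.
Variable R : realType.

Definition unit_interval : Type := set_type (`[0 : R, 1 : R]%classic).

HB.instance Definition _ :=
  Topological.copy unit_interval (set_type (`[0 : R, 1 : R]%classic)).

Lemma unit_interval0 : (0 : R) \in `[0 : R, 1 : R]%classic.
Proof. by apply/mem_set; rewrite /= in_itv /= lexx ler01. Qed.

Lemma unit_interval1 : (1 : R) \in `[0 : R, 1 : R]%classic.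
Proof. by apply/mem_set; rewrite /= in_itv /= lexx ler01. Qed.

Definition I0 : unit_interval := exist _ 0 unit_interval0.
Definition I1 : unit_interval := exist _ 1 unit_interval1.

Lemma I0_neq_I1 : I0 != I1.
Proof. by apply/eqP => -[] /esym/eqP; rewrite oner_eq0. Qed.

HB.instance Definition _ := @isBiPointed.Build unit_interval I0 I1 I0_neq_I1.

End unit_interval.

Section one_connected.
Variable R : realType.
Local Notation I := (unit_interval R).

Definition path_connected (T : topologicalType) : Prop :=
  [set: T] !=set0 /\ forall x y : T, inhabited {path I from x to y}.

Definition path_homotopic (T : topologicalType) (x y : T)
    (p q : {path I from x to y}) : Prop :=
  exists H : I * I -> T,
    [/\ continuous H,
        forall s, H (s, zero) = p s,
        forall s, H (s, one) = q s,
        forall t, H (zero, t) = x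
      & forall t, H (one, t) = y].

Definition path_class (T : topologicalType) (x y : T) (p : {path I from x to y})
    : set {path I from x to y} :=
  [set q | path_homotopic p q].

(* The underlying set of the fundamental group; its neutral element is the
   class of the constant loop. *)
Definition pi1 (T : topologicalType) (x : T)
    : set (set {path I from x to x}) :=
  range (@path_class T x x).

Definition pi1_trivial (T : topologicalType) (x : T) : Prop :=
  @pi1 T x = [set path_class (cst x : {path I from x to x})].

Definition one_connected (T : topologicalType) : Prop :=
  path_connected T /\ forall x : T, @pi1_trivial T x.

Definition homotopic (S T : topologicalType) (f g : S -> T) : Prop :=
  exists H : S * I -> T,
    [/\ continuous H,
        forall s, H (s, zero) = f s
      & forall s, H (s, one) = g s].

Definition homotopy_equivalent (S T : topologicalType) : Prop :=
  exists (f : S -> T) (g : T -> S),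
    [/\ continuous f, continuous g, homotopic (g \o f) id
      & homotopic (f \o g) id].

End one_connected.

Section cw_complex.
Variable R : realType.

(* The norm of 'rV[R]_k in the library is the maximum norm, hence the explicit
   Euclidean balls. *)
Definition sqnorm (k : nat) (v : 'rV[R]_k) : R := \sum_(j < k) v ord0 j ^+ 2.
Definition disk (k : nat) : set 'rV[R]_k := [set v | sqnorm v <= 1].
Definition open_disk (k : nat) : set 'rV[R]_k := [set v | sqnorm v < 1].
Definition sphere (k : nat) : set 'rV[R]_k := [set v | sqnorm v = 1].

(* Only the values of [char_map e] on the closed disk are relevant. *)
Record cell_family (X : topologicalType) := CellFamily {
  cell_index : Type;
  cell_dim : cell_index -> nat;
  char_map : forall e : cell_index, 'rV[R]_(cell_dim e) -> X
}.

Definition cell (X : topologicalType) (C : cell_family X) (e : cell_index C)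
    : set X :=
  @char_map X C e @` open_disk (k := cell_dim e).

(* J. H. C. Whitehead's definition. [cw_continuous], [cw_injective] and
   [cw_open] say that a characteristic map restricts to a homeomorphism from
   the open disk onto the cell. *)
Record cw_decomposition (X : topologicalType) (C : cell_family X) : Prop :=
    CWDecomposition {
  cw_hausdorff : hausdorff_space X;
  cw_disjoint : trivIset [set: cell_index C] (@cell X C);
  cw_cover : \bigcup_(e in [set: cell_index C]) cell e = [set: X];
  cw_continuous : forall e : cell_index C,
    {within disk (k := cell_dim e), continuous (@char_map X C e)};
  cw_injective : forall e : cell_index C,
    {in open_disk (k := cell_dim e) &, injective (@char_map X C e)};
  cw_open : forall (e : cell_index C) (U : set 'rV[R]_(cell_dim e)), open U ->
    exists2 V : set X, open V &
      @char_map X C e @` (U `&` open_disk (k := cell_dim e)) = V `&` cell e;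
  cw_closure_finite : forall e : cell_index C, exists F : set (cell_index C),
    [/\ finite_set F,
        forall d, F d -> (cell_dim d < cell_dim e)%N
      & @char_map X C e @` sphere (k := cell_dim e)
          `<=` \bigcup_(d in F) cell d];
  cw_weak_topology : forall A : set X,
    closed A <-> forall e : cell_index C, closed (A `&` closure (cell e))
}.

Definition is_cw_complex (X : topologicalType) : Prop :=
  exists C : cell_family X, cw_decomposition C.

End cw_complex.

Section loop_space.
Variables (R : realType) (X : ptopologicalType).

Definition loop_space : Type :=
  {path (unit_interval R) from (point : X) to (point : X)}.

(* the compact-open topology *)
HB.instance Definition _ := Topological.on loop_space.

End loop_space.

Section cone.
Variables (R : realType) (Y : topologicalType).
Local Notation I := (unit_interval R).

Let cone_rel' (a b : Y * I) : bool :=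
  (a == b) || (a.2 == one) && (b.2 == one).

Let cone_rel_refl : reflexive cone_rel'.
Proof. by move=> a; rewrite /cone_rel' eqxx. Qed.

Let cone_rel_sym : symmetric cone_rel'.
Proof. by move=> a b; rewrite /cone_rel' eq_sym andbC. Qed.

Let cone_rel_trans : transitive cone_rel'.
Proof.
move=> b a c /predU1P[->//|/andP[a1 b1]] /predU1P[<-|/andP[_ c1]].
  by rewrite /cone_rel' a1 b1 orbT.
by rewrite /cone_rel' a1 c1 orbT.
Qed.

Definition cone_rel := EquivRel _ cone_rel_refl cone_rel_sym cone_rel_trans.

(* The unreduced cone: Y * I with Y * {1} collapsed to a point. *)
Definition cone := {eq_quot cone_rel}.

HB.instance Definition _ := Topological.copy cone (quotient_topology cone).
HB.instance Definition _ := Quotient.on cone.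

Definition cone_base : set cone := range (fun y : Y => \pi_cone (y, zero : I)).

End cone.

Definition simplicial_complex (n : nat) (K : {set {set 'I_n}}) : Prop :=
  [/\ finset.set0 \in K,
      forall i : 'I_n, finset.set1 i \in K
    & forall s t : {set 'I_n}, t \subset s -> s \in K -> t \in K].

Section polyhedral_product.
Variables (n : nat) (K : {set {set 'I_n}}).
Variables (X : 'I_n -> topologicalType) (A : forall i, set (X i)).

Definition pp_block (s : {set 'I_n}) : set (prod_topology X) :=
  [set x | forall i, (if i \in s then [set: X i] else @A i) (x i)].

Definition polyhedral_product : set (prod_topology X) :=
  \bigcup_(s in [set s | s \in K]) pp_block s.

End polyhedral_product.

(* Z_K(CY, Y) with the subspace topology *)
Definition cone_polyhedral_product (R : realType) (n : nat)
    (K : {set {set 'I_n}}) (Y : 'I_n -> topologicalType) : topologicalType :=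
  set_type (polyhedral_product K (fun i => @cone_base R (Y i))).

(* Main.v *)
Require Import Defs.
From mathcomp Require Import all_boot all_order all_algebra generic_quotient.
From mathcomp Require Import all_classical all_reals topology.
From mathcomp Require Import normedtype homotopy.
From mathcomp Require Import lra.

(** The theorem is an instance of a general fact: the polyhedral product of the
    pairs (C Y_i, Y_i) is 1-connected for every family of path-connected spaces
    Y_i ([cone_polyhedral_product_one_connected]).  The loop space of a simply
    connected space is path-connected because a homotopy of loops is a path of
    loops ([loop_space_path_connected]), and path-connectedness passes along
    homotopy equivalences ([homotopy_equivalent_path_connected]).

    A point of the cone has a height, which is 0 on the base and 1 at the apex.
    Call support of a point of the product of the cones the set of the
    coordinates of nonzero height: the polyhedral product is the set of points
    whose support is a simplex ([polyhedral_productP]).  Hence a homotopy in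
    the product stays in the polyhedral product as soon as one controls
    supports, coordinate by coordinate.

    Two facts make loops contractible.  First, a based loop q in one block
    D(s), which is a product, is null-homotopic in the whole polyhedral product
    ([product_null]): reparametrize its coordinates independently, so that they
    move one after the other; the loop stays in D(s).  Afterwards at most one
    coordinate differs from the base point at any time, and it may be
    contracted in its cone because every vertex is a simplex.

    Second, every loop can be cut into pieces that lie in single blocks.  The
    blocks are not open, so the loop is first moved by the homotopy that
    collapses the heights below 1/2 to 0: then, near each time t, the supports
    of the moved loop lie in the support of the original loop at t, a simplex
    ([push_support_near]).  Every point x is joined to the base point
    by a path whose supports stay in the support of x
    ([exists_contracting_paths]); the ends of each piece are joined to the base
    point in this way, the resulting loop lies in one block and bounds
    ([strip_filling]), and consecutive strips share their common side, so they
    paste ([fill_trans], [exists_filling]).  This contracts the loop freely;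
    [free_null_based] turns that into a contraction with fixed end points.

    Paths and homotopies are handled as maps on the real line and on the real
    plane, of which only the restriction to the unit interval or square
    matters; [clamp], the retraction of the line onto the interval, makes most
    of the formulas total. *)

Set Implicit Arguments.
Unset Strict Implicit.
Unset Printing Implicit Defensive.

Import Order.TTheory GRing.Theory Num.Theory.
Import numFieldNormedType.Exports.

Local Open Scope classical_set_scope.
Local Open Scope ring_scope.
Local Open Scope quotient_scope.

(** * Continuity of composite and piecewise maps *)

Section continuity.
Variable R : realType.

Lemma cont_comp (S T U : topologicalType) (g : T -> U) (f : S -> T) :
  continuous g -> continuous f -> continuous (fun x => g (f x)).
Proof. by move=> cg cf x; apply: continuous_comp; [exact: cf|exact: cg]. Qed.

Lemma cont_pair (S T U : topologicalType) (f : S -> T) (g : S -> U) :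
  continuous f -> continuous g -> continuous (fun x => (f x, g x)).
Proof. by move=> cf cg x; apply: cvg_pair; [exact: cf|exact: cg]. Qed.

Lemma cont_comp2 (S T U V : topologicalType) (h : T -> U -> V) (f : S -> T)
    (g : S -> U) : continuous (fun p : T * U => h p.1 p.2) ->
  continuous f -> continuous g -> continuous (fun x => h (f x) (g x)).
Proof.
move=> ch cf cg.
exact: (@cont_comp _ _ _ _ (fun x => (f x, g x)) ch (cont_pair cf cg)).
Qed.

Lemma cont_fst (T U : topologicalType) : continuous (fun p : T * U => p.1).
Proof. by move=> p; exact: cvg_fst. Qed.

Lemma cont_snd (T U : topologicalType) : continuous (fun p : T * U => p.2).
Proof. by move=> p; exact: cvg_snd. Qed.

Lemma cont_id (T : topologicalType) : continuous (fun p : T => p).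
Proof. by move=> x. Qed.

Lemma cont_cst (T U : topologicalType) (u : U) : continuous (fun _ : T => u).
Proof. by move=> x; exact: cvg_cst. Qed.

Lemma cont_mull (a : R) : continuous (fun x : R => a * x).
Proof. by move=> x; apply: cvgM; [exact: cvg_cst|exact: cvg_id]. Qed.

Variable S : topologicalType.
Implicit Types f g : S -> R.

Lemma cont_add f g : continuous f -> continuous g ->
  continuous (fun x => f x + g x).
Proof. by move=> cf cg x; apply: cvgD; [exact: cf|exact: cg]. Qed.

Lemma cont_opp f : continuous f -> continuous (fun x => - f x).
Proof. by move=> cf x; apply: cvgN; exact: cf. Qed.

Lemma cont_mul f g : continuous f -> continuous g ->
  continuous (fun x => f x * g x).
Proof. by move=> cf cg x; apply: cvgM; [exact: cf|exact: cg]. Qed.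

Lemma cont_min f g : continuous f -> continuous g ->
  continuous (fun x => Num.min (f x) (g x)).
Proof. by move=> cf cg x; apply: continuous_min; [exact: cf|exact: cg]. Qed.

Lemma cont_max f g : continuous f -> continuous g ->
  continuous (fun x => Num.max (f x) (g x)).
Proof. by move=> cf cg x; apply: continuous_max; [exact: cf|exact: cg]. Qed.

(** Every concatenation of paths or homotopies below is an instance: [u] is the
    parameter along which the pieces are glued at the value [c]. *)
Lemma pasting (T : topologicalType) (u : S -> R) (c : R) (f g : S -> T) :
  continuous u -> continuous f -> continuous g ->
  (forall x, u x = c -> f x = g x) ->
  continuous (fun x => if u x <= c then f x else g x).
Proof.
move=> cu cf cg fg; set h := fun x => _.
have cA : closed [set x | u x <= c].
  apply: (@preimage_closed _ _ u [set y | y <= c]); last exact: closed_le.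
  by move=> x _; exact: cu.
have cB : closed [set x | c <= u x].
  apply: (@preimage_closed _ _ u [set y | c <= y]); last exact: closed_ge.
  by move=> x _; exact: cu.
apply/continuous_subspace_setT.
have -> : [set: S] = [set x | u x <= c] `|` [set x | c <= u x].
  by apply/seteqP; split=> x //= _; apply/orP; exact: le_total.
apply: withinU_continuous => //.
- apply: (@subspace_eq_continuous _ _ _ f); last exact: continuous_subspaceT.
  by move=> x; rewrite inE /= /from_subspace /h => ->.
- apply: (@subspace_eq_continuous _ _ _ g); last exact: continuous_subspaceT.
  move=> x; rewrite inE /= /from_subspace /h => cx.
  by case: ifP => // xc; rewrite fg//; apply/eqP; rewrite eq_le xc.
Qed.

Lemma cont_prod (J : eqType) (X : J -> topologicalType)
    (h : S -> prod_topology X) :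
  (forall j, continuous (fun x => h x j)) -> continuous h.
Proof.
move=> ch x; apply/cvg_sup => j U.
move=> -[V [[W oW <-] Wx WU]]; apply: filterS WU _.
by apply: ch; apply: open_nbhs_nbhs.
Qed.

Lemma cont_proj (J : eqType) (X : J -> topologicalType) (j : J)
    (h : S -> prod_topology X) : continuous h -> continuous (fun x => h x j).
Proof.
move=> ch; apply: (@cont_comp _ (prod_topology X) _ (fun z => z j)) => //.
exact: proj_continuous.
Qed.

Lemma cont_val (X : topologicalType) (A : set X) (f : S -> set_type A) :
  continuous (fun x => \val (f x)) -> continuous f.
Proof. exact: continuous_comp_initial. Qed.

Lemma val_cont (X : topologicalType) (A : set X) :
  continuous (fun x : set_type A => \val x).
Proof. exact: initial_continuous. Qed.

End continuity.
(** * The unit interval as a retract of the line *)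

Section unit_interval_maps.
Variable R : realType.
Local Notation I := (unit_interval R).

Definition clamp (x : R) : R := Num.max 0 (Num.min 1 x).

Lemma clamp_itv x : 0 <= clamp x <= 1.
Proof. by rewrite /clamp maxElt minElt; do 2 case: ifPn; rewrite -?leNgt; lra. Qed.

Lemma clamp_in x : clamp x \in `[0 : R, 1 : R]%classic.
Proof. by apply/mem_set; rewrite /= in_itv /= clamp_itv. Qed.

Lemma clamp_id x : 0 <= x <= 1 -> clamp x = x.
Proof.
by move=> ?; rewrite /clamp maxElt minElt; do 2 case: ifPn; rewrite -?leNgt; lra.
Qed.

Lemma clamp_le0 x : x <= 0 -> clamp x = 0.
Proof.
by move=> ?; rewrite /clamp maxElt minElt; do 2 case: ifPn; rewrite -?leNgt; lra.
Qed.

Lemma clamp_ge1 x : 1 <= x -> clamp x = 1.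
Proof.
by move=> ?; rewrite /clamp maxElt minElt; do 2 case: ifPn; rewrite -?leNgt; lra.
Qed.

Lemma clamp0 : clamp 0 = 0. Proof. exact: clamp_le0. Qed.
Lemma clamp1 : clamp 1 = 1. Proof. exact: clamp_ge1. Qed.
Lemma clampK x : clamp (clamp x) = clamp x.
Proof. by rewrite clamp_id// clamp_itv. Qed.

Lemma cont_clamp (S : topologicalType) (f : S -> R) :
  continuous f -> continuous (fun x => clamp (f x)).
Proof. by move=> cf; apply: cont_max; [|apply: cont_min]; do ?exact: cont_cst. Qed.

Definition to_I (x : R) : I := exist _ (clamp x) (clamp_in x).

Definition of_I (i : I) : R := \val i.

Lemma of_IK x : of_I (to_I x) = clamp x. Proof. by []. Qed.

Lemma of_I_itv i : 0 <= of_I i <= 1.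
Proof. by have := set_mem (valP i); rewrite /= in_itv. Qed.

Lemma to_IK i : to_I (of_I i) = i.
Proof. by apply: val_inj; rewrite /= clamp_id// of_I_itv. Qed.

Lemma of_I_inj : injective of_I. Proof. exact: val_inj. Qed.

Lemma of_I0 : of_I zero = 0. Proof. by []. Qed.
Lemma of_I1 : of_I one = 1. Proof. by []. Qed.
Lemma to_I0 : to_I 0 = zero.
Proof. by apply: of_I_inj; rewrite of_IK clamp0. Qed.
Lemma to_I1 : to_I 1 = one.
Proof. by apply: of_I_inj; rewrite of_IK clamp1. Qed.
Lemma to_I_clamp x : to_I (clamp x) = to_I x.
Proof. by apply: of_I_inj; rewrite !of_IK clampK. Qed.

Lemma cont_of_I (S : topologicalType) (f : S -> I) :
  continuous f -> continuous (fun x => of_I (f x)).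
Proof. by move=> cf; apply: cont_comp cf => //; exact: val_cont. Qed.

Lemma cont_to_I (S : topologicalType) (f : S -> R) :
  continuous f -> continuous (fun x => to_I (f x)).
Proof. by move=> cf; apply: cont_val; rewrite /=; exact: cont_clamp. Qed.

End unit_interval_maps.

(** Continuity of the explicit parametrizations used below, by structural
    recursion on the formula; the head symbol alone selects the rule, so that
    no unification up to conversion is attempted. *)
Ltac cont_step := lazymatch goal with
  | |- continuous (fun x => x) => exact: cont_id
  | |- continuous (fun x => fst x) => exact: cont_fst
  | |- continuous (fun x => snd x) => exact: cont_snd
  | |- continuous (@fst _ _) => exact: cont_fst
  | |- continuous (@snd _ _) => exact: cont_snd
  | |- continuous (fun _ => ?c) => exact: cont_cst
  | |- continuous (fun x => @?f x + @?g x) => apply: (@cont_add _ _ f g)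
  | |- continuous (GRing.mul _) => exact: cont_mull
  | |- continuous (fun x => - @?f x) => apply: (@cont_opp _ _ f)
  | |- continuous (fun x => @?f x * @?g x) => apply: (@cont_mul _ _ f g)
  | |- continuous (fun x => Num.min (@?f x) (@?g x)) => apply: (@cont_min _ _ f g)
  | |- continuous (fun x => Num.max (@?f x) (@?g x)) => apply: (@cont_max _ _ f g)
  | |- continuous (fun x => clamp (@?f x)) => apply: (@cont_clamp _ _ f)
  | |- continuous (fun x => to_I (@?f x)) => apply: (@cont_to_I _ _ f)
  | |- continuous (fun x => of_I (@?f x)) => apply: (@cont_of_I _ _ f)
  | |- continuous (fun x => (@?f x, @?g x)) => apply: (@cont_pair _ _ _ f g)
  | |- continuous (fun x => fst (@?f x)) => apply: (cont_comp (@cont_fst _ _) (f := f))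
  | |- continuous (fun x => snd (@?f x)) => apply: (cont_comp (@cont_snd _ _) (f := f))
  | h : continuous ?f |- continuous ?f => exact: h
  end.
Ltac cont := repeat cont_step.

Section unit_interval_paths.
Variable R : realType.
Local Notation I := (unit_interval R).

Lemma path_connectedP (T : topologicalType) (x y : T) :
  path_connected R T -> exists f : R -> T,
  [/\ continuous f, f 0 = x, f 1 = y & forall t, f (clamp t) = f t].
Proof.
move=> [_ /(_ x y)[p]]; exists (fun t => p (to_I t)); split.
- by apply: cont_comp; [exact: cts_fun|apply: cont_to_I; cont].
- by rewrite to_I0 path_zero.
- by rewrite to_I1 path_one.
- by move=> t; rewrite to_I_clamp.
Qed.

Lemma real_path_inhabited (T : topologicalType) (x y : T) (f : R -> T) :
  continuous f -> f 0 = x -> f 1 = y -> inhabited {path I from x to y}.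
Proof.
move=> cf f0 f1; have cg : continuous (fun i : I => f (of_I i)).
  by apply: cont_comp => //; apply: cont_of_I; cont.
by constructor; exact: (mk_path cg (f0 : f (of_I zero) = x) f1).
Qed.

End unit_interval_paths.

(** * Cones: height, foot and maps acting on heights *)

Section cone_theory.
Variables (R : realType) (Y : topologicalType).
Local Notation I := (unit_interval R).
Local Notation cone := (cone R Y).

Definition cone_pt (y : Y) (h : R) : cone := \pi_cone (y, to_I h).
Definition height (x : cone) : R := of_I (repr x).2.
Definition foot (x : cone) : Y := (repr x).1.

Lemma cone_ptE (x : cone) : cone_pt (foot x) (height x) = x.
Proof.
by rewrite /cone_pt /foot /height to_IK -surjective_pairing reprK.
Qed.

Lemma pi_coneP (a b : Y * I) :
  reflect (\pi_cone a = \pi_cone b :> cone) (cone_rel R Y a b).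
Proof. exact: (@eqmodP _ (cone_rel R Y)). Qed.

Lemma cone_relP (a b : Y * I) :
  reflect (a = b \/ of_I a.2 = 1 /\ of_I b.2 = 1) (cone_rel R Y a b).
Proof.
apply: (iffP orP) => -[/eqP|]; try by left.
- by move=> /andP[/eqP -> /eqP ->]; right; rewrite of_I1.
- by move=> [a1 b1]; right; apply/andP; split; apply/eqP; apply: of_I_inj.
Qed.

Lemma height_pt y h : height (cone_pt y h) = clamp h.
Proof.
have : \pi_cone (repr (cone_pt y h)) = \pi_cone (y, to_I h) :> cone.
  by rewrite reprK.
move=> /pi_coneP/cone_relP[|[]]; rewrite /height.
  by move=> ->.
by move=> -> /= <-; rewrite of_IK.
Qed.

(** At height 1 the foot is an arbitrary choice of representative. *)
Lemma foot_pt y h : h < 1 -> foot (cone_pt y h) = y.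
Proof.
move=> h1; have : \pi_cone (repr (cone_pt y h)) = \pi_cone (y, to_I h) :> cone.
  by rewrite reprK.
move=> /pi_coneP/cone_relP[|[_]]; rewrite /foot.
  by move=> ->.
rewrite of_IK => hE; exfalso; move: hE.
by have [h0|h0] := leP h 0; [rewrite clamp_le0|rewrite clamp_id]; lra.
Qed.

Lemma height_itv x : 0 <= height x <= 1.
Proof. exact: of_I_itv. Qed.

Lemma apex_eq y y' : cone_pt y 1 = cone_pt y' 1.
Proof.
by apply/pi_coneP/cone_relP; right; rewrite of_IK clamp1.
Qed.

Lemma cone_baseP x : cone_base x <-> height x = 0.
Proof.
split=> [[y _ <-]|h0].
  by rewrite -to_I0 -/(cone_pt y 0) height_pt clamp0.
by exists (foot x) => //; rewrite -to_I0 -h0; exact: cone_ptE.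
Qed.

Lemma cont_cone_pt (S : topologicalType) (f : S -> Y) (g : S -> R) :
  continuous f -> continuous g -> continuous (fun x => cone_pt (f x) (g x)).
Proof.
move=> cf cg; apply: (cont_comp (@pi_continuous _ _)).
by apply: cont_pair => //; exact: cont_to_I.
Qed.

Lemma cont_height (S : topologicalType) (f : S -> cone) :
  continuous f -> continuous (fun x => height (f x)).
Proof.
move=> cf; apply: cont_comp cf => {f S}.
apply/quotient_continuous; rewrite /comp.
have -> : (fun x => height (\pi_cone x)) = (fun x : Y * I => of_I x.2).
  apply/funext => -[y i]; have := height_pt y (of_I i).
  by rewrite /cone_pt to_IK clamp_id ?of_I_itv.
by apply: cont_of_I; cont.
Qed.

End cone_theory.
Section cone_map.
Variables (R : realType) (Y : topologicalType).
Local Notation I := (unit_interval R).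
Local Notation cone := (cone R Y).

Definition cone_map (phi : R -> R -> R) (x : cone) (t : R) : cone :=
  cone_pt (foot x) (phi (height x) t).

Variable phi : R -> R -> R.
Hypothesis phi_cont : continuous (fun p : R * R => phi p.1 p.2).
Hypothesis phi_bound : forall h t, 0 <= h <= 1 -> 2 * h - 1 <= phi h t <= 1.

Let phi1 t : phi 1 t = 1.
Proof. by have := @phi_bound 1 t; lra. Qed.

Lemma cone_map_pt y i t :
  cone_map phi (\pi_cone (y, i)) t = cone_pt y (phi (of_I i) t).
Proof.
have E : \pi_cone (y, i) = cone_pt y (of_I i) by rewrite /cone_pt to_IK.
rewrite E /cone_map height_pt clamp_id ?of_I_itv//.
have := of_I_itv i; have [i1 _|i1 i01] := ltP (of_I i) 1.
  by rewrite foot_pt.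
have -> : of_I i = 1 by lra.
by rewrite phi1; exact: apex_eq.
Qed.

(** The apex is the only point with several representatives, so a set of
    representatives is saturated as soon as it contains all or none of the
    points (y, 1). *)
Lemma saturated_open (A : set (Y * I)) : open A ->
  (forall y y', A (y, one) -> A (y', one)) ->
  open ((fun q => \pi_cone q : cone) @` A).
Proof.
move=> oA satA; rewrite /open /= /quotient_open.
suff -> : \pi_cone @^-1` ((fun q => \pi_cone q : cone) @` A) = A by [].
apply/seteqP; split=> [[y i] /= [[y' i'] Aq /pi_coneP/cone_relP[[<- <-]//|]]|].
  move=> [/= i1 i1']; have E (j : I) : of_I j = 1 -> j = one.
    by move=> j1; apply: of_I_inj; rewrite of_I1.
  by rewrite (E _ i1'); rewrite (E _ i1) in Aq; exact: satA Aq.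
by move=> q Aq; exists q.
Qed.

(** Since [Y] need not be locally compact, the product of the quotient map onto
    the cone with the identity of R has to be treated by hand.  Away from the
    apex the cone is an open part of [Y * I].  At the apex, a neighbourhood
    contains over each y a segment of heights above some r < 1, with r
    depending on y; the lower bound on [phi] ensures that the heights above
    (1 + r) / 2 are sent into that segment for all t at once. *)
Lemma cont_cone_map : continuous (fun p : cone * R => cone_map phi p.1 p.2).
Proof.
move=> [x t0] V0; rewrite nbhsE => -[V [oV Vx] VV0].
suff : nbhs (x, t0) [set p : cone * R | V (cone_map phi p.1 p.2)].
  by apply: filterS => p Vp; exact: VV0.
rewrite /= in Vx; have {V0 VV0} xE : x = \pi_cone ((repr x).1, (repr x).2).
  by rewrite -surjective_pairing reprK.
have [x1|x1] := ltP (height x) 1.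
- pose F (p : (Y * I) * R) := cone_pt p.1.1 (phi (of_I p.1.2) p.2).
  have cF : continuous F.
    apply: cont_cone_pt; first by apply: cont_comp; cont.
    apply: (cont_comp2 phi_cont); last by cont.
    by apply: cont_of_I; apply: cont_comp; cont.
  have [[A B] /= [Ax Bt] AB] : nbhs (repr x, t0) (F @^-1` V).
    by apply: cF; apply: open_nbhs_nbhs.
  pose A' := interior A `&` [set q | of_I q.2 < 1].
  have oA' : open A'.
    apply: openI; first exact: open_interior.
    have cu : continuous (fun q : Y * I => of_I q.2) by apply: cont_of_I; cont.
    by move/continuousP : cu => /(_ [set h | h < 1]); apply; exact: open_lt.
  exists ((fun q => \pi_cone q : cone) @` A', B).
    split => //=; apply: open_nbhs_nbhs; split.
      apply: saturated_open => // y y' [_] /=; rewrite of_I1.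
      by rewrite ltxx.
    by exists (repr x); [split=> //|rewrite reprK].
  move=> [_ t] [/= [[y i] [Ayi i1] <-] Bt'].
  rewrite /= cone_map_pt; apply: (AB ((y, i), t)); split => //=.
  exact: interior_subset Ayi.
- pose V' : set (Y * I) := [set q | V (\pi_cone q)].
  pose A' : set (Y * I) := [set q | exists (P : set Y) (r : R),
    [/\ open P, P q.1, r < 2 * of_I q.2 - 1
      & forall y j, P y -> r < of_I j -> V' (y, j)]].
  have topA y : A' (y, one).
    have V'y : nbhs (y, one : I) V'.
      apply: open_nbhs_nbhs; split; first exact: oV.
      rewrite /V' /=; suff <- : cone_map phi x t0 = \pi_cone (y, one) by [].
      rewrite xE cone_map_pt.
      have -> : of_I (repr x).2 = 1.
        by have := height_itv x; rewrite /height in x1 *; lra.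
      by rewrite phi1 -to_I1; exact: apex_eq.
    case: V'y => -[P Q] /= [Py Q1] PQ.
    have : nbhs (1 : R) [set h : R | Q (to_I h)].
      have cI : continuous (fun h : R => to_I h) by apply: cont_to_I; cont.
      by apply: cI; rewrite to_I1.
    move=> /nbhs_ballP[e /= e0 be].
    exists (interior P), (1 - e); split.
    + exact: open_interior.
    + exact: Py.
    + by rewrite /= of_I1; lra.
    + move=> y' j Py' ej; apply: PQ; split => /=; first exact: interior_subset.
      rewrite -(to_IK j); apply: be; rewrite /ball /= ltr_distl.
      by have := of_I_itv j; lra.
  have oA' : open A'.
    rewrite openE => -[y i] [P [r [oP Py ri VP]]]; rewrite /interior.
    exists (P, [set j | r < 2 * of_I j - 1]) => /=.
      split; first exact: open_nbhs_nbhs.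
      apply: open_nbhs_nbhs; split => //.
      have cu : continuous (fun j : I => 2 * of_I j - 1).
        by cont; apply: cont_of_I; cont.
      by move/continuousP : cu => /(_ [set h | r < h]); apply; exact: open_gt.
    by move=> [y' i'] [/= Py' ri']; exists P, r.
  (* the bound on [phi] is uniform in [t], whence the full line here *)
  exists ((fun q => \pi_cone q : cone) @` A', setT).
    split => //=; last exact: filterT.
    apply: open_nbhs_nbhs; split; first exact: saturated_open.
    exists ((repr x).1, one) => //.
    rewrite [RHS]xE; congr (\pi_cone (_, _)); apply: of_I_inj; rewrite of_I1.
    by have := height_itv x; rewrite /height in x1 *; lra.
  move=> [_ t] [/= [[y i] [P [r [oP Py ri VP]]] <-] _].
  rewrite cone_map_pt; apply: VP => //; rewrite of_IK.
  have := @phi_bound (of_I i) t (of_I_itv i) => ib; rewrite /= in ri.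
  have [p0|p0] := leP 0 (phi (of_I i) t); first by rewrite clamp_id; lra.
  by rewrite clamp_le0; lra.
Qed.

End cone_map.
(** * From free to based null homotopies *)

Section null_homotopies.
Variable R : realType.

Definition continuous2 (T : topologicalType) (G : R -> R -> T) :=
  continuous (fun p : R * R => G p.1 p.2).

Definition null_homotopy (T : Type) (q : R -> T) (b : T) (N : R -> R -> T) :=
  [/\ forall t, N t 0 = q (clamp t), forall s, N 0 s = b, forall s, N 1 s = b
    & forall t, N t 1 = b].

(** Let [a] be the path followed by the end points during the free contraction
    [G].  In the square, slide the bottom side, with fixed end points, to the
    path going along the three other sides; since [G] is constant on the top
    side, the loop becomes [a] followed by its reverse, which then retracts to
    its starting point. *)
Lemma free_null_based (T : topologicalType) (G : R -> R -> T) (z : T) :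
  continuous2 G -> (forall s, G 0 s = G 1 s) ->
  (forall t, 0 <= t <= 1 -> G t 1 = z) ->
  exists2 N, continuous2 N & null_homotopy (fun t => G t 0) (G 0 0) N.
Proof.
move=> cG G01 Gz.
(* the ordinate, at time t, of the path along the left, top and right sides;
   its abscissa is [clamp (3 * clamp t - 1)] *)
pose tent (t : R) := Num.min (clamp (3 * clamp t)) (clamp (3 - 3 * clamp t)).
have tent0 : tent 0 = 0.
  by rewrite /tent clamp0 mulr0 clamp0 minEle (andP (clamp_itv _)).1.
have tent1 : tent 1 = 0.
  by rewrite /tent clamp1 mulr1 subrr clamp0 minC minEle (andP (clamp_itv _)).1.
exists (fun t s => if s <= 2^-1
  then G (clamp t + clamp (2 * s) * (clamp (3 * clamp t - 1) - clamp t))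
         (clamp (2 * s) * tent t)
  else G 0 (tent t * clamp (2 - 2 * s))).
  rewrite /continuous2 /tent; apply: pasting; first by cont.
  - by apply: (cont_comp2 cG); cont.
  - by apply: (cont_comp2 cG); cont.
  - move=> -[t s] /= ->; rewrite divff ?pnatr_eq0// clamp1 !mul1r.
    rewrite -/(tent t) (_ : 2 - 1 = 1 :> R); last by lra.
    rewrite clamp1 mulr1 addrCA subrr addr0.
    have t01 := clamp_itv t.
    have [t1|t1] := leP (3 * clamp t) 1.
      by rewrite [clamp (_ - 1)]clamp_le0//; lra.
    have [t2|t2] := leP 2 (3 * clamp t).
      by rewrite [clamp (_ - 1)]clamp_ge1 ?G01//; lra.
    have -> : tent t = 1.
      rewrite /tent (@clamp_ge1 _ (3 * _)); last by lra.
      by rewrite (@clamp_ge1 _ (3 - _)) ?minxx//; lra.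
    by rewrite !Gz// ?lexx ?ler01// clamp_itv.
split=> [t|s|s|t].
- by rewrite mulr0 clamp0 !mul0r addr0 invr_ge0 ler0n.
- rewrite tent0 clamp0 mulr0 mul0r (@clamp_le0 _ (0 - 1)); last by lra.
  by rewrite subrr !mulr0 addr0; case: ifP.
- rewrite tent1 clamp1 mulr0 mul0r (@clamp_ge1 _ (3 * 1 - 1)); last by lra.
  by rewrite subrr !mulr0 addr0; case: ifP.
- rewrite ifF; last by apply/negbTE; rewrite -ltNge; lra.
  by rewrite mulr1 subrr clamp0 mulr0.
Qed.

(** The cone contracts to its apex by raising heights. *)
Lemma cone_null (Y : topologicalType) (q : R -> cone R Y) :
  continuous q -> q 0 = q 1 ->
  exists2 N, continuous2 N & null_homotopy q (q 0) N.
Proof.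
move=> cq q01; pose phi (h t : R) := h + clamp t * (1 - h).
have E x : cone_map phi x 0 = x.
  by rewrite /cone_map /phi clamp0 mul0r addr0 cone_ptE.
have [|||N cN nN] :=
  @free_null_based _ (fun t s => cone_map phi (q t) s) (cone_pt (foot (q 0)) 1).
- have cphi : continuous (fun p : cone R Y * R => cone_map phi p.1 p.2).
    apply: cont_cone_map.
      by rewrite /phi; cont.
    move=> h t h01; rewrite /phi; have t01 := clamp_itv t.
    by apply/andP; split; nra.
  by apply: (cont_comp2 cphi); cont; apply: cont_comp; cont.
- by move=> s; rewrite q01.
- move=> t _; rewrite /cone_map /phi clamp1 mul1r addrC subrK.
  exact: apex_eq.
- exists N => //; case: nN => N0 N1 N2 N3.
  by split=> [t|s|s|t]; rewrite ?N0 ?N1 ?N2 ?N3 E.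
Qed.

End null_homotopies.
(** * Loops in a product of cones *)

Section cone_products.
Variables (R : realType) (n : nat) (K : {set {set 'I_n}}).
Hypothesis scK : simplicial_complex K.
Variable Y : 'I_n -> topologicalType.
Local Notation P := (prod_topology (fun i => cone R (Y i))).

Definition support (x : P) : {set 'I_n} := finset (fun i => height (x i) != 0).

Lemma in_support x i : (i \in support x) = (height (x i) != 0).
Proof. by rewrite inE. Qed.

Lemma notin_support x i : (i \notin support x) = (height (x i) == 0).
Proof. by rewrite in_support negbK. Qed.

Lemma K_sub (s t : {set 'I_n}) : s \in K -> t \subset s -> t \in K.
Proof. by case: scK => _ _ down sK ts; exact: down ts sK. Qed.

Lemma polyhedral_productP (x : P) :
  polyhedral_product K (fun i => @cone_base R (Y i)) x <-> support x \in K.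
Proof.
split=> [[s /= sK xs]|xK].
  apply: K_sub sK _; apply/fintype.subsetP => i; apply: contraTT => nis.
  by have := xs i; rewrite (negbTE nis) notin_support => /cone_baseP ->.
exists (support x) => // i; case: ifPn => // /[!notin_support] /eqP.
by move/cone_baseP.
Qed.

Lemma lift_polyhedral (S : topologicalType) (h : S -> P) : continuous h ->
  (forall x, support (h x) \in K) ->
  exists2 F : S -> cone_polyhedral_product R K Y, continuous F &
    forall x, \val (F x) = h x.
Proof.
move=> ch hK; have hZ x := mem_set ((polyhedral_productP (h x)).2 (hK x)).
by exists (fun x => exist _ (h x) (hZ x)) => //; apply: cont_val.
Qed.

(** For u <= 1/2 the coordinates are brought from the common parameter [t] to
    [c i t], which runs from 0 to 1 while [t] runs through the i-th of n equal
    subintervals; different parameters in different coordinates do not leave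
    the block of [s].  For u >= 1/2 the coordinates are contracted, and only
    the one whose parameter is inside ]0, 1[ can leave the base. *)
Lemma product_null (s : {set 'I_n}) (q : R -> P) (b : P) : s \in K ->
  continuous q -> (forall u, support (q u) \subset s) ->
  q 0 = b -> q 1 = b -> support b = finset.set0 ->
  exists N : R -> R -> P, [/\ continuous2 N, null_homotopy q b N &
    forall t u, support (N t u) \in K].
Proof.
move=> sK cq qs q0 q1 b0.
have exN (i : 'I_n) : exists N : R -> R -> cone R (Y i),
    continuous2 N /\ null_homotopy (fun u => q u i) (b i) N.
  have [||N cN nN] := @cone_null R (Y i) (fun u => q u i).
  - exact: (@cont_proj _ _ _ i q cq).
  - by rewrite q0 q1.
  by exists N; split => //; rewrite -q0.
pose N i := sval (cid (exN i)).
have NP i : continuous2 (N i) /\ null_homotopy (fun u => q u i) (b i) (N i).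
  exact: svalP (cid (exN i)).
pose c (i : 'I_n) (t : R) := clamp (n%:R * clamp t - (i : nat)%:R).
have c0 i : c i 0 = 0.
  by rewrite /c clamp0 mulr0 clamp_le0// sub0r oppr_le0.
have c1 i : c i 1 = 1.
  by rewrite /c clamp1 mulr1 clamp_ge1// lerBrDr addrC natr1 ler_nat.
exists (fun t u i => N i (clamp t + clamp (2 * u) * (c i t - clamp t))
                         (clamp (2 * u - 1))); split.
- apply: cont_prod => i; have [cN _] := NP i; rewrite /c.
  by apply: (cont_comp2 cN); cont.
- split=> [t|u|u|t]; apply: functional_extensionality_dep => i;
    have [_ [N0 N1 N2 N3]] := NP i.
  + by rewrite mulr0 clamp0 mul0r addr0 (@clamp_le0 _ (_ - 1)) ?N0 ?clampK//; lra.
  + by rewrite c0 clamp0 subrr mulr0 addr0.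
  + by rewrite c1 clamp1 subrr mulr0 addr0.
  + by rewrite (@clamp_ge1 _ (2 * 1 - 1)) ?N3//; lra.
- move=> t u; set x : P := fun i => _.
  have [u1|u1] := leP u 2^-1.
    apply: (K_sub sK); apply/fintype.subsetP => i; rewrite in_support /x.
    rewrite (@clamp_le0 _ (2 * u - 1)); last by lra.
    have [_ [-> _ _ _]] := NP i.
    by rewrite -in_support; apply/fintype.subsetP.
  have xE i : x i = N i (c i t) (clamp (2 * u - 1)).
    rewrite /x (@clamp_ge1 _ (2 * u)); last by lra.
    by rewrite mul1r addrC subrK.
  have xi i : i \in support x -> 0 < n%:R * clamp t - (i : nat)%:R < 1.
    rewrite in_support xE; apply: contraR.
    have bi : height (b i) == 0 by rewrite -notin_support b0 inE.
    have [_ [N0 N1 N2 N3]] := NP i.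
    rewrite negb_and -!leNgt /c => /orP[?|?].
      by rewrite clamp_le0// N1.
    by rewrite clamp_ge1// N2.
  have [->|[i ix]] := set_0Vmem (support x); first by case: scK.
  have [_ K1 _] := scK.
  apply: K_sub (K1 i) _; apply/fintype.subsetP => j jx; rewrite finset.in_set1.
  have := xi _ ix; have := xi _ jx => jt it.
  have ij : ((i : nat)%:R : R) < (j : nat).+1%:R by rewrite -natr1; lra.
  have ji : ((j : nat)%:R : R) < (i : nat).+1%:R by rewrite -natr1; lra.
  rewrite !ltr_nat !ltnS in ij ji.
  by apply/eqP/val_inj/eqP; rewrite eqn_leq ij ji.
Qed.

End cone_products.
(** Compactness of the interval, in the form needed for subdivisions: a
    transitive relation between reals that holds between points close to any
    given one holds between 0 and 1.  The supremum of the points related to 0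
    is itself related to 0, and is 1. *)
Lemma interval_chain (R : realType) (Q : R -> R -> Prop) :
  (forall a e f, a < e -> e < f -> Q a e -> Q e f -> Q a f) ->
  (forall t, 0 <= t <= 1 -> exists2 d, 0 < d &
     forall a e, a < e -> t - d < a -> e < t + d -> Q a e) ->
  Q 0 1.
Proof.
move=> Qtrans Qloc; pose A := [set t | 0 < t <= 1 /\ Q 0 t].
have [|d d0 Qd] := Qloc 0; first by rewrite lexx ler01.
have A0 : A (Num.min (d / 2) 1).
  rewrite /A minElt; case: ifPn; rewrite -?leNgt => ? /=;
    by split; [lra|apply: Qd; lra].
have hA : has_sup A.
  by split; [exists (Num.min (d / 2) 1)|exists 1 => t [] /andP[]].
have ubA := ub_le_sup hA.2.
have S01 : 0 <= sup A <= 1.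
  apply/andP; split.
    by apply: le_trans (ubA _ A0); case: A0 => /andP[/ltW].
  by apply: ge_sup => [|t [] /andP[]//]; exists (Num.min (d / 2) 1).
have {Qd d d0 A0} [d d0 Qd] := Qloc _ S01.
have [t1 At1 t1S] := sup_adherent d0 hA.
have t1S' := ubA _ At1; have [t1_01 Qt1] := At1.
have step t2 : sup A <= t2 -> t2 < sup A + d -> t2 <= 1 -> A t2.
  move=> St2 t2S t2_1; have [t12|t12] := ltP t1 t2.
    split; first by lra.
    by apply: Qtrans Qt1 (Qd _ _ _ _ _); lra.
  by have -> : t2 = t1 by lra.
have [S1|S1] := leP 1 (sup A + d / 2).
  by have [|||] // := step 1; lra.
have := ubA _ (step (sup A + d / 2) _ _ _); lra.
Qed.

(** * Contracting a path block by block *)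

Section fillings.
Variables (R : realType) (n : nat) (K : {set {set 'I_n}}).
Hypothesis scK : simplicial_complex K.
Variable Y : 'I_n -> topologicalType.
Local Notation P := (prod_topology (fun i => cone R (Y i))).

Definition contracting_paths (b : P) (c : P -> R -> P) :=
  forall x, [/\ continuous (c x), c x 0 = x, c x 1 = b,
    forall t, c x (clamp t) = c x t & forall t, support (c x t) \subset support x].

(** A single formula serves all points: descend to the base while the foot
    follows a path to the base point of [Y i].  A coordinate that is in the
    base stays there. *)
Lemma exists_contracting_paths : (forall i, path_connected R (Y i)) ->
  exists b c, support b = finset.set0 /\ contracting_paths b c.
Proof.
move=> pcY.
pose y0 i : Y i := sval (cid (pcY i).1).
have exf i (y : Y i) := cid (path_connectedP y (y0 i) (pcY i)).
pose f i (y : Y i) : R -> Y i := sval (exf i y).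
have fP i y : [/\ continuous (f i y), f i y 0 = y, f i y 1 = y0 i &
  forall t, f i y (clamp t) = f i y t] := svalP (exf i y).
exists (fun i => cone_pt (y0 i) 0).
exists (fun x t i => cone_pt (f i (foot (x i)) t) ((1 - clamp t) * height (x i))).
split.
  apply/setP => i; rewrite in_support height_pt clamp0 eqxx.
  by rewrite inE.
move=> x; split.
- apply: cont_prod => i; have [cf _ _ _] := fP i (foot (x i)).
  by apply: cont_cone_pt => //; apply: cont_mul; cont; apply: cont_clamp; cont.
- apply: functional_extensionality_dep => i; have [_ f0 _ _] := fP i (foot (x i)).
  by rewrite f0 clamp0 subr0 mul1r cone_ptE.
- apply: functional_extensionality_dep => i; have [_ _ f1 _] := fP i (foot (x i)).
  by rewrite f1 clamp1 subrr mul0r.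
- move=> t; apply: functional_extensionality_dep => i.
  by have [_ _ _ fc] := fP i (foot (x i)); rewrite fc clampK.
- move=> t; apply/fintype.subsetP => i; rewrite !in_support.
  by apply: contraNN => /eqP ->; rewrite height_pt mulr0 clamp0.
Qed.

Variables (b : P) (c : P -> R -> P).
Hypotheses (b0 : support b = finset.set0) (cP : contracting_paths b c).
Variable g : R -> P.
Hypothesis cg : continuous g.

(** The sides are run through on [0, 1/2] and are then constant: this leaves the
    upper half of the square for the null homotopy of the boundary.  They
    depend only on [g a] and [g e], so that adjacent fillings agree. *)
Definition filling (a e : R) (H : R -> R -> P) :=
  [/\ continuous2 H,
      forall t, a <= t <= e -> H t 0 = g t /\ H t 1 = b,
      forall s, H a s = c (g a) (2 * s),
      forall s, H e s = c (g e) (2 * s)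
    & forall t s, support (H t s) \in K].

Lemma fill_trans a e f : a < e -> e < f ->
  (exists H, filling a e H) -> (exists H, filling e f H) ->
  exists H, filling a f H.
Proof.
move=> ae ef [H [cH H01 Ha He HK]] [G [cG G01 Ge Gf GK]].
exists (fun t s => if t <= e then H t s else G t s); split.
- apply: pasting => //; first by cont.
  by move=> -[t s] /= ->; rewrite He Ge.
- move=> t tI; have [te|te] := leP t e.
    by apply: H01; rewrite te andbT; case/andP: tI.
  by apply: G01; rewrite (ltW te); case/andP: tI.
- by move=> s; rewrite (ltW ae) Ha.
- by move=> s; rewrite leNgt ef /= Gf.
- by move=> t s; case: ifP.
Qed.

(** The left side reversed, the bottom and the right side form a loop [q] based
    at [b] in the block of [s].  If [N] contracts it, the filling consists of
    the homotopy, inside the image of [q], from its middle third to the whole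
    of [q], followed by [N]. *)
Lemma strip_filling (s : {set 'I_n}) a e : s \in K -> a < e ->
  (forall t, a <= t <= e -> support (g t) \subset s) ->
  exists H, filling a e H.
Proof.
move=> sK ae gs; have ae0 : 0 < e - a by lra.
pose q u : P := if u <= 3^-1 then c (g a) (1 - 3 * u)
  else if u <= 2 / 3 then g (a + clamp (3 * u - 1) * (e - a))
  else c (g e) (3 * u - 2).
have [[cca ca0 ca1 cac cas] [cce ce0 ce1 cec ces]] := (cP (g a), cP (g e)).
have q1 u : 3 * u <= 1 -> q u = c (g a) (1 - 3 * u).
  by move=> u1; rewrite /q ifT//; lra.
have q2 u : 1 <= 3 * u <= 2 -> q u = g (a + (3 * u - 1) * (e - a)).
  move=> u1; rewrite /q; case: ifPn => [u2|_].
    have -> : 3 * u - 1 = 0 by lra.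
    have -> : 1 - 3 * u = 0 by lra.
    by rewrite ca0 mul0r addr0.
  by rewrite ifT ?clamp_id//; lra.
have q3 u : 2 <= 3 * u -> q u = c (g e) (3 * u - 2).
  move=> u2; rewrite /q ifF; last by apply/negbTE; rewrite -ltNge; lra.
  case: ifPn => // u3; have -> : 3 * u - 1 = 1 by lra.
  have -> : 3 * u - 2 = 0 by lra.
  by rewrite ce0 clamp1 mul1r addrC subrK.
have cq : continuous q.
  apply: pasting; first by cont.
  - by apply: (cont_comp cca); cont.
  - apply: pasting; first by cont.
    + by apply: (cont_comp cg); cont.
    + by apply: (cont_comp cce); cont.
    + move=> u ->; rewrite (_ : 3 * _ - 1 = 1); last by lra.
      rewrite (_ : 3 * _ - 2 = 0); last by lra.
      by rewrite ce0 clamp1 mul1r addrC subrK.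
  - move=> u ->; rewrite ifT; last by lra.
    rewrite (_ : 3 * _ - 1 = 0); last by lra.
    rewrite (_ : 1 - _ = 0); last by lra.
    by rewrite ca0 clamp0 mul0r addr0.
have sg t : a <= t <= e -> support (g t) \subset s by exact: gs.
have qs u : support (q u) \subset s.
  rewrite /q; case: ifP => _; last case: ifP => _.
  - by apply: fintype.subset_trans (cas _) (gs _ _); lra.
  - by apply: gs; have := clamp_itv (3 * u - 1); nra.
  - by apply: fintype.subset_trans (ces _) (gs _ _); lra.
have [||N [cN [N0 N1 N2 N3] NK]] := product_null scK sK cq qs _ _ b0.
- by rewrite q1 ?mulr0 ?subr0//; lra.
- rewrite q3; last by lra.
  by have -> : 3 * 1 - 2 = 1 :> R by lra.
pose w (t : R) := clamp ((t - a) / (e - a)).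
have wa : w a = 0 by rewrite /w subrr mul0r clamp0.
have we : w e = 1 by rewrite /w divff ?clamp1// gt_eqF.
have wE t : a <= t <= e -> a + w t * (e - a) = t.
  move=> tI; rewrite /w clamp_id; first by rewrite divfK ?gt_eqF//; lra.
  by rewrite ler_pdivlMr// ler_pdivrMr//; lra.
exists (fun t s => N ((1 + w t + clamp (2 * s) * (2 * w t - 1)) / 3)
                     (clamp (2 * s - 1))); split.
- rewrite /w; apply: (cont_comp2 cN); cont.
- move=> t tI; have w01 := clamp_itv ((t - a) / (e - a)); split.
    rewrite mulr0 clamp0 mul0r addr0 sub0r (@clamp_le0 _ (- 1)); last by lra.
    rewrite N0 clamp_id; last by rewrite -/(w t) in w01 *; lra.
    rewrite q2; last by rewrite -/(w t) in w01 *; lra.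
    by congr g; rewrite -[RHS]wE//; congr (_ + _ * _); lra.
  by rewrite (@clamp_ge1 _ (2 * 1 - 1)) ?N3//; lra.
- move=> u; rewrite wa mulr0 addr0 sub0r mulrN1.
  have m01 := clamp_itv (2 * u); have [u1|u1] := leP (2 * u) 1.
    rewrite (@clamp_le0 _ (2 * u - 1)) ?N0; last by lra.
    rewrite clamp_id; last by lra.
    rewrite q1; last by lra.
    by rewrite -[RHS]cac; congr (c _ _); lra.
  rewrite (@clamp_ge1 _ (2 * u)) ?subrr ?mul0r ?N1; last by lra.
  by rewrite -cac clamp_ge1 ?ca1//; lra.
- move=> u; rewrite we mulr1.
  have -> : 2 - 1 = 1 :> R by lra.
  rewrite mulr1.
  have m01 := clamp_itv (2 * u); have [u1|u1] := leP (2 * u) 1.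
    rewrite (@clamp_le0 _ (2 * u - 1)) ?N0; last by lra.
    rewrite clamp_id; last by lra.
    rewrite q3; last by lra.
    by rewrite -[RHS]cec; congr (c _ _); lra.
  rewrite (@clamp_ge1 _ (2 * u)); last by lra.
  have -> : (1 + 1 + 1) / 3 = 1 :> R by lra.
  rewrite N2.
  by rewrite -cec clamp_ge1 ?ce1//; lra.
- by move=> t u; exact: NK.
Qed.

Lemma exists_filling :
  (forall t : R, exists2 s, s \in K & \forall u \near t, support (g u) \subset s) ->
  exists H, filling 0 1 H.
Proof.
move=> gloc; apply: (@interval_chain R (fun a e => exists H, filling a e H)).
  exact: fill_trans.
move=> t _; have [s sK /nbhs_ballP[d /= d0 ds]] := gloc t.
exists d => // a e ae ta et; apply: (strip_filling sK ae) => u ue.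
by apply: ds; rewrite /ball /= ltr_distlC; lra.
Qed.

End fillings.
(** * Path-connectedness and triviality of the fundamental group *)

Section joined_points.
Variables (R : realType) (T : topologicalType).

Definition joined (x y : T) :=
  exists f : R -> T, [/\ continuous f, f 0 = x & f 1 = y].

Lemma joined_sym x y : joined x y -> joined y x.
Proof.
move=> [f [cf f0 f1]]; exists (fun t => f (1 - t)); split.
- by apply: (cont_comp cf); cont.
- by rewrite subr0.
- by rewrite subrr.
Qed.

Lemma joined_trans x y z : joined x y -> joined y z -> joined x z.
Proof.
move=> [f [cf f0 f1]] [g [cg g0 g1]].
exists (fun t => if t <= 2^-1 then f (2 * t) else g (2 * t - 1)); split.
- apply: pasting; first by cont.
  + by apply: (cont_comp cf); cont.
  + by apply: (cont_comp cg); cont.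
  + by move=> t ->; rewrite divff ?pnatr_eq0// subrr f1 g0.
- by rewrite invr_ge0 ler0n mulr0.
- rewrite ifF; last by apply/negbTE; rewrite -ltNge; lra.
  by rewrite mulr1 (_ : 2 - 1 = 1 :> R)//; lra.
Qed.

Lemma path_connected_joined : path_connected R T -> forall x y, joined x y.
Proof. by move=> pc x y; have [f []] := path_connectedP x y pc; exists f. Qed.

Lemma joined_path_connected (b : T) : (forall x, joined x b) ->
  path_connected R T.
Proof.
move=> jb; split; first by exists b.
move=> x y; have [f [cf f0 f1]] := joined_trans (jb x) (joined_sym (jb y)).
exact: real_path_inhabited cf f0 f1.
Qed.

Lemma pi1_trivial_null (x : T) :
  (forall f : R -> T, continuous f -> f 0 = f 1 ->
    exists2 N, continuous2 N & null_homotopy f (f 0) N) ->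
  @pi1_trivial R T x.
Proof.
move=> nullT.
have hom (p q : {path unit_interval R from x to x}) : path_homotopic p q.
  have ext (r : {path unit_interval R from x to x}) :
      exists2 N, continuous2 N & null_homotopy (fun t => r (to_I t)) x N.
    have [||N cN] := nullT (fun t : R => r (to_I t)).
    - by apply: cont_comp; [exact: cts_fun|apply: cont_to_I; cont].
    - by rewrite to_I0 to_I1 path_zero path_one.
    by rewrite to_I0 path_zero; exists N.
  have [[M cM [M0 M1 M2 M3]] [N cN [N0 N1 N2 N3]]] := (ext p, ext q).
  exists (fun a => if of_I a.2 <= 2^-1 then M (of_I a.1) (2 * of_I a.2)
                   else N (of_I a.1) (2 - 2 * of_I a.2)); split.
  - have c1 := cont_of_I (@cont_fst (unit_interval R) (unit_interval R)).
    have c2 := cont_of_I (@cont_snd (unit_interval R) (unit_interval R)).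
    apply: pasting => //.
    + by apply: (cont_comp2 cM); cont.
    + by apply: (cont_comp2 cN); cont.
    + move=> a ->; rewrite divff ?pnatr_eq0// M3.
      by rewrite (_ : 2 - 1 = 1 :> R) ?N3//; lra.
  - move=> s /=; rewrite of_I0 invr_ge0 ler0n mulr0 M0.
    by rewrite to_I_clamp to_IK.
  - move=> s /=; rewrite of_I1 ifF; last by apply/negbTE; rewrite -ltNge; lra.
    by rewrite mulr1 subrr N0 to_I_clamp to_IK.
  - by move=> t /=; rewrite of_I0 M1 N1; case: ifP.
  - by move=> t /=; rewrite of_I1 M2 N2; case: ifP.
have cls (p q : {path unit_interval R from x to x}) :
    path_class p = path_class q.
  by apply/seteqP; split=> r _; exact: hom.
apply/seteqP; split=> [_ [p _ <-]|_ ->]; first exact: cls.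
by exists (cst x).
Qed.

End joined_points.

(** * Polyhedral products of cones over path-connected spaces *)

Section cone_polyhedral_products.
Variables (R : realType) (n : nat) (K : {set {set 'I_n}}).
Hypothesis scK : simplicial_complex K.
Variable Y : 'I_n -> topologicalType.
Hypothesis pcY : forall i, path_connected R (Y i).
Local Notation P := (prod_topology (fun i => cone R (Y i))).
Local Notation Z := (cone_polyhedral_product R K Y).

Lemma val_support (z : Z) : support (\val z : P) \in K.
Proof. by apply/(polyhedral_productP scK); exact: set_mem (valP z). Qed.

Lemma polyhedral_path_connected : path_connected R Z.
Proof.
have [b [c [b0 cP]]] := exists_contracting_paths pcY.
have path_to (x : P) : support x \in K -> exists2 F : R -> Z, continuous F &
    \val (F 0) = x /\ \val (F 1) = b.
  move=> xK; have [cc c0 c1 _ cs] := cP x.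
  have [|F cF FE] := lift_polyhedral scK cc.
    by move=> t; apply: K_sub (cs t).
  by exists F; rewrite // !FE.
have [F _ [_ Fb]] := path_to b (ltac:(by rewrite b0; case: scK)).
apply: (@joined_path_connected _ _ (F 1)) => z.
have [G cG [G0 G1]] := path_to _ (val_support z).
exists G; split => //; apply: val_inj; first exact: G0.
by rewrite [LHS]G1 [RHS]Fb.
Qed.

(** For t = 1 heights at most 1/2 become 0 and [1/2, 1] is stretched onto
    [0, 1]. *)
Let push_height (h t : R) := (1 - clamp t) * h + clamp t * Num.max 0 (2 * h - 1).

Lemma push_bound h t : 0 <= h <= 1 -> 2 * h - 1 <= push_height h t <= 1.
Proof.
move=> h01; rewrite /push_height; have t01 := clamp_itv t.
have m1 : 0 <= Num.max 0 (2 * h - 1) by rewrite le_max lexx.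
have m2 : 2 * h - 1 <= Num.max 0 (2 * h - 1) by rewrite le_max lexx orbT.
have m3 : Num.max 0 (2 * h - 1) <= 1 by rewrite ge_max ler01/=; lra.
by apply/andP; split; nra.
Qed.

Lemma push_cont : continuous (fun p : R * R => push_height p.1 p.2).
Proof. by rewrite /push_height; cont. Qed.

Definition push (x : P) (t : R) : P := fun i => cone_map push_height (x i) t.

Lemma push0 x : push x 0 = x.
Proof.
apply: functional_extensionality_dep => i.
rewrite /push /cone_map /push_height clamp0 subr0 mul1r mul0r addr0.
exact: cone_ptE.
Qed.

Lemma push_support x t : support (push x t) \subset support x.
Proof.
apply/fintype.subsetP => i; rewrite !in_support; apply: contraNN => /eqP hi.
rewrite /push /cone_map hi height_pt /push_height mulr0 add0r mulr0.
by rewrite max_l ?mulr0 ?clamp0//; lra.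
Qed.

Lemma cont_push (S : topologicalType) (f : S -> P) (u : S -> R) :
  continuous f -> continuous u -> continuous (fun x => push (f x) (u x)).
Proof.
move=> cf cu; apply: cont_prod => i.
have cm := cont_cone_map push_cont push_bound (Y := Y i).
by apply: (cont_comp2 cm) => //; exact: (@cont_proj _ _ _ i f cf).
Qed.

(** A coordinate of [f t] of height 0 has height less than 1/2 nearby, hence
    height 0 after the push. *)
Lemma push_support_near (f : R -> P) (t : R) : continuous f ->
  \forall u \near t, support (push (f u) 1) \subset support (f t).
Proof.
move=> cf.
have near_i (i : 'I_n) : \forall u \near t,
    i \in support (push (f u) 1) -> i \in support (f t).
  have [it|] := boolP (i \in support (f t)); first by apply: filterE => u _.
  rewrite notin_support => /eqP hi.
  have ch : continuous (fun u => height (f u i)).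
    by apply: cont_height; exact: (@cont_proj _ _ _ i f cf).
  have : \forall u \near t, height (f u i) < 2^-1.
    apply: (ch t [set h | h < 2^-1]).
    by apply: open_nbhs_nbhs; split; [exact: open_lt|rewrite /= hi invr_gt0].
  apply: filterS => u hu; rewrite in_support.
  rewrite /push /cone_map height_pt /push_height clamp1 subrr mul0r add0r mul1r.
  by rewrite max_l ?clamp0 ?eqxx//; lra.
have : \forall u \near t, forall i : 'I_n,
    i \in support (push (f u) 1) -> i \in support (f t).
  exact: (@filter_forall R _ (fun i u => i \in support (push (f u) 1) ->
    i \in support (f t)) (nbhs t) _ near_i).
by apply: filterS => u hu; apply/fintype.subsetP => i; exact: hu.
Qed.

(** Push the loop, then contract the result with the filling over the whole
    interval, whose two sides coincide because the loop is closed. *)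
Lemma polyhedral_loop_null (f : R -> Z) : continuous f -> f 0 = f 1 ->
  exists2 N, continuous2 N & null_homotopy f (f 0) N.
Proof.
move=> cf f01; have [b [c [b0 cP]]] := exists_contracting_paths pcY.
pose v t : P := \val (f t); pose g t := push (v t) 1.
have cv : continuous v by apply: (cont_comp (@val_cont _ _)).
have cg : continuous g by apply: cont_push => //; cont.
have [|H [cH H01 H0 H1 HK]] := exists_filling scK b0 cP cg.
  move=> t; exists (support (v t)); first exact: val_support.
  exact: push_support_near.
pose D t s : P := if s <= 2^-1 then push (v (clamp t)) (2 * s)
                  else H (clamp t) (2 * s - 1).
have cD : continuous2 D.
  apply: pasting; first by cont.
  - apply: cont_push; last by cont.
    by apply: (cont_comp cv); apply: cont_clamp; cont.
  - by apply: (cont_comp2 cH); cont.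
  - move=> -[t s] /= ->; rewrite divff ?pnatr_eq0// subrr.
    by have [-> _] := H01 _ (clamp_itv t).
have D1 t : D t 1 = b.
  rewrite /D ifF; last by apply/negbTE; rewrite -ltNge; lra.
  have -> : 2 * 1 - 1 = 1 :> R by lra.
  by have [_ ->] := H01 _ (clamp_itv t).
have DK p : support (D p.1 p.2) \in K.
  rewrite /D; case: ifP => _; last exact: HK.
  exact: K_sub scK _ _ (val_support _) (push_support _ _).
have [F cF FE] := lift_polyhedral scK cD DK.
have F0 t : F (t, 0) = f (clamp t).
  apply: val_inj; rewrite [LHS]FE /D /= invr_ge0 ler0n mulr0.
  exact: push0.
have [|||N cN nN] := @free_null_based _ _ (fun t s => F (t, s)) (F (0, 1)).
- by apply: (cont_comp cF); cont.
- move=> s; apply: val_inj; rewrite [LHS]FE [RHS]FE /D /= clamp0 clamp1.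
  by rewrite H0 H1 /g /v f01.
- by move=> t _; apply: val_inj; rewrite [LHS]FE [RHS]FE !D1.
exists N => //; case: nN; rewrite F0 clamp0 => N0 N1 N2 N3.
by split => // t; rewrite N0 F0 clampK.
Qed.

Theorem cone_polyhedral_product_one_connected : one_connected R Z.
Proof.
split; first exact: polyhedral_path_connected.
by move=> x; apply: pi1_trivial_null; exact: polyhedral_loop_null.
Qed.

End cone_polyhedral_products.

(** * Loop spaces and homotopy equivalences *)

Section loop_spaces.
Variable R : realType.
Local Notation I := (unit_interval R).

Lemma path_homotopic_refl (T : topologicalType) (x y : T)
    (p : {path I from x to y}) : path_homotopic p p.
Proof.
exists (fun a => p a.1); split => // [|t|t].
- by apply: cont_comp; [exact: cts_fun|cont].
- by rewrite path_zero.
- by rewrite path_one.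
Qed.

(** A path homotopy between two loops is, by currying, a continuous path between
    them for the compact-open topology. *)
Lemma loop_space_path_connected (X : ptopologicalType) :
  one_connected R X -> path_connected R (loop_space R X).
Proof.
move=> [_ /(_ point) pi1X]; split.
  by exists (cst (point : X) : {path I from (point : X) to point}).
move=> p q; have cls (r : loop_space R X) :
    path_class r =
    path_class (cst (point : X) : {path I from (point : X) to point}).
  suff : @pi1 R X point (path_class r) by rewrite pi1X.
  by exists r.
have [H [cH Hp Hq H0 H1]] : path_homotopic p q.
  suff : path_class p q by [].
  by rewrite (cls p) -(cls q); exact: path_homotopic_refl.
have cHt t : continuous (fun s => H (s, t)) by apply: (cont_comp cH); cont.
pose h (t : I) : loop_space R X := mk_path (cHt t) (H0 t) (H1 t).
have ch : continuous h.
  apply: continuous_comp_initial.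
  apply: (@continuous_curry_fun I I X (fun a => H (a.2, a.1))).
  by apply: (cont_comp cH); cont.
constructor; apply: (mk_path ch).
- by apply/path_eqP => s; rewrite /= /h /mk_path Hp.
- by apply/path_eqP => s; rewrite /= /h /mk_path Hq.
Qed.

(** The homotopy from [f \o g] to the identity joins each point to the image of
    [f], which is path-connected. *)
Lemma homotopy_equivalent_path_connected (S T : topologicalType) :
  homotopy_equivalent R S T -> path_connected R S -> path_connected R T.
Proof.
move=> [f [g [cf cg _ [H [cH H0 H1]]]]] pcS.
have [s0 _] := pcS.1.
apply: (@joined_path_connected _ _ (f s0)) => y.
have yfg : joined R (f (g y)) y.
  exists (fun t => H (y, to_I t)); split.
  - by apply: (cont_comp cH); cont; apply: cont_to_I; cont.
  - by rewrite to_I0 H0.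
  - by rewrite to_I1 H1.
apply: joined_trans (joined_sym yfg) _.
have [p [cp p0 p1]] := path_connected_joined pcS (g y) s0.
exists (fun t => f (p t)); split; last 2 first.
- by rewrite p0.
- by rewrite p1.
by apply: cont_comp.
Qed.

End loop_spaces.

Theorem theorem1p3 (R : realType) (n : nat) (K : {set {set 'I_n}})
    (hK : simplicial_complex K) (X : 'I_n -> ptopologicalType)
    (hcw : forall i, is_cw_complex R (X i))
    (hX : forall i, one_connected R (X i)) :
  one_connected R
    (cone_polyhedral_product R K (fun i => loop_space R (X i)))
  /\ forall Y : 'I_n -> topologicalType,
       (forall i, is_cw_complex R (Y i)) ->
       (forall i, homotopy_equivalent R (loop_space R (X i)) (Y i)) ->
       one_connected R (cone_polyhedral_product R K Y).
Proof.
have pcL i := loop_space_path_connected (hX i).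
split; first exact: cone_polyhedral_product_one_connected.
move=> Y _ hY; apply: cone_polyhedral_product_one_connected => // i.
exact: homotopy_equivalent_path_connected (hY i) (pcL i).
Qed.
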